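(* Let $L|K$ be an extension of fields, $\nu$ a $K$-module valuation on $L$, and $\chi\in L$ algebraic or transcendental over $K$. Let $d<d'$ in $\mathbb{N}\cup\{\infty\}$ be such that if $\chi$ is algebraic over $K$, then $d'<[K[\chi]:K]$. 1) $(K_{d'}[\chi]|K_d[\chi],\nu)$ is immediate if, and only if, for every integer $n\in\{d+1,\dots,d'\}$ (that is, $d+1\le n\le d'$), $\nu(\chi^n-K_{n-1}[\chi])$ has no maximal element. 2) Assume that $\nu$ is a pm valuation and that $\nu K_d[\chi]$ is a subgroup of $\nu(K[\chi])$ (i.e. it is a subgroup of the ordered value group). Then the extension $(K_{d'}[\chi]|K_d[\chi],\nu)$ is dense if, and only if, for every integer $n\in\{d+1,\dots,d'\}$, $\nu(\chi^n-K_{n-1}[\chi])=\nu K_d[\chi]$.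
   Context: A $K$-module valuation on $L$ is a map $\nu:L\to\Gamma\cup\{\infty\}$, $\Gamma$ a linearly ordered abelian group, such that $\nu(y)=\infty\Leftrightarrow y=0$, $\nu(y_1+y_2)\ge\min(\nu(y_1),\nu(y_2))$ and $\nu(xy)=\nu(x)+\nu(y)$ for all $x\in K$, $y,y_1,y_2\in L$. (So $\nu|_K$ is a field valuation.) It is assumed that $\nu K$ has finite rank (finitely many convex subgroups). For a subset $M$ of $L$, $\nu M=\nu(M):=\{\nu(x):x\in M\}\setminus\{\infty\}$; for $l\in L$ and a $K$-submodule $M$, $\nu(l-M):=\{\nu(l-x):x\in M\}\setminus\{\infty\}$. It is assumed that for the $K$-modules $M$ considered, $\nu M$ has no greatest element (this holds if $\nu K$ is non-trivial). $K_m[\chi]$ is the $K$-module of polynomials in $\chi$ with coefficients in $K$ of degree at most $m$; $K_0[\chi]=K$ and, in the transcendental case, $K_\infty[\chi]=K[\chi]$. Let $M\subseteq N$ be $K$-submodules of $L$ and $l\in L$. The element $l$ is pseudo-limit over $(M,\nu)$ if $\nu(l-M)\subseteq\nu M$ and $\nu(l-M)$ has no maximal element; $l$ is limit over $(M,\nu)$ if $\nu(l-M)=\nu M$. $(N|M,\nu)$ is immediate (resp. dense) if every element of $N$ is pseudo-limit (resp. limit) over $(M,\nu)$. $\nu$ is a pm (partially multiplicative) valuation if $\nu(fg)=\nu(f)+\nu(g)$ for all $f,g\in K[\chi]$ with $\deg(f)+\deg(g)<[K[\chi]:K]$ (when $\chi$ is algebraic, elements of $K[\chi]$ are written as polynomials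 in $\chi$ of degree $<[K[\chi]:K]$); if $\chi$ is transcendental one requires moreover that $\nu$ is a field valuation on $K(\chi)$ in the usual sense. *)

(* Defs.v *)
From HB Require Import structures.
From mathcomp Require Import all_boot all_order all_algebra.
From mathcomp Require Import boolp classical_sets cardinality.

Set Implicit Arguments.
Unset Strict Implicit.
Unset Printing Implicit Defensive.

Import Order.TTheory GRing.Theory Num.Theory.
Local Open Scope classical_set_scope.
Local Open Scope ring_scope.

(* MathComp's porderZmodType imposes no compatibility between order and
   addition, hence this structure of linearly ordered abelian groups. *)
HB.mixin Record isLinearlyOrderedGroup G of Num.POrderedZmodule G := {
  oag_le_total : total (<=%R : rel G);
  oag_leD2l : forall x y z : G, y <= z -> x + y <= x + z
}.

#[short(type="oagType")]
HB.structure Definition OrderedAbelianGroup :=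
  {G of Num.POrderedZmodule G & isLinearlyOrderedGroup G}.

(* Both Gamma \cup {oo} and N \cup {oo} are rendered as option types, with
   None standing for oo. *)
Definition leinf d (T : porderType d) (x y : option T) : bool :=
  match x, y with
  | _, None => true
  | None, Some _ => false
  | Some a, Some b => (a <= b)%O
  end.

Definition ltinf d (T : porderType d) (x y : option T) : bool :=
  match x, y with
  | None, _ => false
  | Some _, None => true
  | Some a, Some b => (a < b)%O
  end.

Definition mininf d (T : porderType d) (x y : option T) : option T :=
  if leinf x y then x else y.

Definition addinf (G : zmodType) (x y : option G) : option G :=
  match x, y with
  | Some a, Some b => Some (a + b)
  | _, _ => None
  end.

Section OrderedGroup.
Variable G : oagType.
Implicit Types A H : set G.

Definition no_greatest A : Prop := ~ exists2 a, A a & ubound A a.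

Definition is_subgroup H : Prop :=
  [/\ H 0, forall x y, H x -> H y -> H (x + y) & forall x, H x -> H (- x)].

Definition convex_subgroup A H : Prop :=
  [/\ H `<=` A, is_subgroup H
    & forall x y z, H x -> H z -> A y -> x <= y -> y <= z -> H y].

Definition finite_rank A : Prop := finite_set [set H | convex_subgroup A H].

End OrderedGroup.

Section Extension.
Variables (K L : fieldType) (iota : {rmorphism K -> L}).

Definition Kbasis (V : set L) n (b : 'I_n -> L) : Prop :=
  [/\ forall i, V (b i),
      forall v, V v -> exists c : 'I_n -> K, v = \sum_i iota (c i) * b i
    & forall c : 'I_n -> K,
        \sum_i iota (c i) * b i = 0 -> forall i, c i = 0].

(* None (that is, oo) if V has no finite basis. *)
Definition Kdim (V : set L) : option nat :=
  xget None [set Some n | n in [set n | exists b : 'I_n -> L, Kbasis V b]].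

Variable chi : L.

Definition Keval (p : {poly K}) : L := (map_poly iota p).[chi].

(* Kpoly m is K_m[chi]; size p <= m.+1 says that p has degree at most m. *)
Definition Kpoly (m : option nat) : set L :=
  match m with
  | Some m => [set Keval p | p in [set p : {poly K} | (size p <= m.+1)%N]]
  | None => range Keval
  end.

Definition Kfrac : set L :=
  [set y | exists p q, Keval q != 0 /\ y = Keval p / Keval q].

Definition Kdegree : option nat := Kdim (range Keval).

Variables (G : oagType) (nu : L -> option G).

Definition module_valuation : Prop :=
  [/\ forall y, nu y = None <-> y = 0,
      forall y1 y2, leinf (mininf (nu y1) (nu y2)) (nu (y1 + y2))
    & forall x y, nu (iota x * y) = addinf (nu (iota x)) (nu y)].

Definition field_valuation_on (F : set L) : Prop :=
  [/\ forall y, F y -> (nu y = None <-> y = 0),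
      forall y1 y2, F y1 -> F y2 ->
        leinf (mininf (nu y1) (nu y2)) (nu (y1 + y2))
    & forall y1 y2, F y1 -> F y2 -> nu (y1 * y2) = addinf (nu y1) (nu y2)].

(* The degree (size f).-1 of the zero polynomial is 0 here; this is harmless
   since nu 0 = oo. *)
Definition pm_valuation : Prop :=
  (forall f g : {poly K},
     ltinf (Some ((size f).-1 + (size g).-1)%N) Kdegree ->
     nu (Keval f * Keval g) = addinf (nu (Keval f)) (nu (Keval g))) /\
  (~ algebraicOver iota chi -> field_valuation_on Kfrac).

End Extension.

Section Values.
Variables (L : fieldType) (G : oagType) (nu : L -> option G).
Implicit Types (M N : set L) (l : L).

Definition values M : set G := [set g | exists2 x, M x & nu x = Some g].

Definition dist_values l M : set G := values [set l - x | x in M].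

Definition pseudo_limit M l : Prop :=
  dist_values l M `<=` values M /\ no_greatest (dist_values l M).

Definition is_limit M l : Prop := dist_values l M = values M.

(* The extension N|M, for K-submodules M \subseteq N of L. *)
Definition immediate N M : Prop := forall l, N l -> pseudo_limit M l.

Definition dense_ext N M : Prop := forall l, N l -> is_limit M l.

End Values.

(* Main.v *)
Require Import Defs.
From HB Require Import structures.
From mathcomp Require Import all_boot all_order all_algebra.
From mathcomp Require Import boolp classical_sets cardinality.

(* An element l of N is pseudo-limit over M precisely when each nonzero l - x,
with x in M, can be improved: some z in M has nu (l - x) < nu (l - z). This
property is transitive along towers of submodules and is inherited by
iota c * l + y for y in M, so climbing the tower K_n[chi] one degree at a time
it only has to be checked on the powers of chi. The dense case is the same
climb with the bound nu (l - x) replaced by an arbitrary value of M; translation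
of the values of K_d[chi] by nu K handles the leading coefficient. *)

Set Implicit Arguments.
Unset Strict Implicit.
Unset Printing Implicit Defensive.

Import Order.TTheory GRing.Theory Num.Theory.
Local Open Scope classical_set_scope.
Local Open Scope ring_scope.

(** * Linearly ordered abelian groups with a point at infinity *)

Section OrderedGroupFacts.
Variable G : oagType.
Implicit Types (x y z : G) (u v w : option G).

Lemma oag_nle_lt x y : ~ (x <= y) -> y < x.
Proof.
move=> nxy; have /orP [//|lyx] := oag_le_total x y.
rewrite lt_neqAle lyx andbT; apply/eqP => eyx.
by apply: nxy; rewrite eyx.
Qed.

Lemma oag_ltD2l x y z : y < z -> x + y < x + z.
Proof.
rewrite !lt_neqAle => /andP [neq le]; rewrite oag_leD2l // andbT.
by apply: contra neq => /eqP /addrI ->.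
Qed.

(** A positive x gives 0 < x < x + x, and symmetrically for a negative one. The absence of 2-torsion
    serves to compute nu (-1). *)
Lemma oag_addrr_eq0 x : x + x = 0 -> x = 0.
Proof.
move=> xx0; have [//|nx] := eqVneq x 0.
have /orP [le0|le0] := oag_le_total 0 x.
  have lt0 : 0 < x by rewrite lt_neqAle eq_sym nx.
  by have := oag_ltD2l x lt0; rewrite addr0 xx0 => /(lt_trans lt0); rewrite ltxx.
have lt0 : x < 0 by rewrite lt_neqAle nx.
by have := oag_ltD2l x lt0; rewrite addr0 xx0 => /lt_trans /(_ lt0); rewrite ltxx.
Qed.

Lemma ltinf_le_trans u v w : ltinf u v -> leinf v w -> ltinf u w.
Proof. by case: u v w => [x|] [y|] [z|] //=; apply: lt_le_trans. Qed.

Lemma ltinf_nle u v : ltinf u v -> ~~ leinf v u.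
Proof.
case: u v => [x|] [y|] //= lt; apply/negP => le.
by have := lt_le_trans lt le; rewrite ltxx.
Qed.

Lemma ltinfxx u : ltinf u u = false.
Proof. by case: u => [x|] //=; rewrite ltxx. Qed.

Lemma ltinf_mininf u v w : ltinf u v -> ltinf u w -> ltinf u (mininf v w).
Proof. by rewrite /mininf; case: ifP. Qed.

Lemma leinf_anti u v : leinf u v -> leinf v u -> u = v.
Proof.
case: u v => [x|] [y|] //= le1 le2; congr Some.
by apply/eqP; rewrite eq_le le1.
Qed.

Lemma no_greatest_lt (A : set G) g :
  no_greatest A -> A g -> exists2 h, A h & g < h.
Proof.
move=> ngA Ag; apply: contrapT => none; apply: ngA; exists g => // h Ah.
by apply: contrapT => /oag_nle_lt gh; apply: none; exists h.
Qed.

End OrderedGroupFacts.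

Lemma leinf_pred n (m : option nat) : leinf (Some n.+1) m -> leinf (Some n) m.
Proof. by case: m => //= m; rewrite !leEnat; apply: ltnW. Qed.

(** * Module valuations and approximation from a submodule *)

Definition submodule (K L : fieldType) (iota : {rmorphism K -> L}) (M : set L) :=
  [/\ M 0, forall x y, M x -> M y -> M (x + y)
    & forall c x, M x -> M (iota c * x)].

(** The choice z = l, with nu (l - z) = oo, is allowed, so elements of M itself satisfy the
    condition. *)
Definition improvable (L : fieldType) (G : oagType) (nu : L -> option G)
    (M : set L) (l : L) :=
  forall x, M x -> l != x -> exists2 z, M z & ltinf (nu (l - x)) (nu (l - z)).

Section ModuleValuation.
Variables (K L : fieldType) (iota : {rmorphism K -> L}).
Variables (G : oagType) (nu : L -> option G).
Hypothesis nu_val : module_valuation iota nu.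
Implicit Types (M N : set L) (l x y z : L) (g h : G).

Lemma submoduleB M x y : submodule iota M -> M x -> M y -> M (x - y).
Proof.
move=> [_ MD MZ] Mx My; apply: MD => //.
by rewrite -mulN1r -(rmorph1 iota) -rmorphN; apply: MZ.
Qed.

Lemma val0 : nu 0 = None.
Proof. by case: nu_val => nu0 _ _; apply/nu0. Qed.

Lemma val_neq0 y : y != 0 -> exists g, nu y = Some g.
Proof.
move=> ny; case E: (nu y) => [g|]; first by exists g.
by case: nu_val => nu0 _ _; move: ny; rewrite (iffLR (nu0 y) E) eqxx.
Qed.

Lemma val_Some_neq0 y g : nu y = Some g -> y != 0.
Proof. by move=> yg; apply/eqP => y0; rewrite y0 val0 in yg. Qed.

Lemma valM c y : nu (iota c * y) = addinf (nu (iota c)) (nu y).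
Proof. by case: nu_val. Qed.

Lemma val1 : nu 1 = Some 0.
Proof.
have [g Eg] := val_neq0 (oner_neq0 L); rewrite Eg; congr Some.
(* Multiplicativity is available because the first factor 1 comes from K; it gives g = g + g. *)
have := valM 1 1; rewrite rmorph1 mulr1 Eg /= => - [].
by rewrite -{1}[g]addr0 => /addrI.
Qed.

(** Since -1 comes from K, nu (-1) + nu (-1) = nu 1 = 0, hence nu (-1) = 0 and multiplication by -1
    preserves values. *)
Lemma valN y : nu (- y) = nu y.
Proof.
have n1 : (-1 : L) != 0 by rewrite oppr_eq0 oner_neq0.
have iN1 : iota (-1) = -1 by rewrite rmorphN rmorph1.
have [g Eg] := val_neq0 n1.
have := valM (-1) (-1); rewrite iN1 mulrNN mulr1 val1 Eg /= => - [] /esym.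
move/oag_addrr_eq0 => g0; have := valM (-1) y.
by rewrite iN1 mulN1r Eg g0 => ->; case: (nu y) => //= h; rewrite add0r.
Qed.

Lemma valB x y : nu (x - y) = nu (y - x).
Proof. by rewrite -valN opprB. Qed.

Lemma ltinf_valD u x y :
  ltinf u (nu x) -> ltinf u (nu y) -> ltinf u (nu (x + y)).
Proof.
move=> ux uy; case: nu_val => _ nuD _.
exact: ltinf_le_trans (ltinf_mininf ux uy) (nuD x y).
Qed.

Lemma valD_lt x y : ltinf (nu x) (nu y) -> nu (x + y) = nu x.
Proof.
move=> xy; case: nu_val => _ nuD _; apply: leinf_anti; last first.
  have := nuD x y; rewrite /mininf; case: ifP => // /negbT.
  by move: (nu x) (nu y) xy => [a|] [b|] //= /ltW ->.
(* Writing x = (x + y) - y bounds nu x below by the minimum of nu (x + y) and nu y; that minimum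
   cannot be nu y. *)
have := nuD (x + y) (- y); rewrite addrK valN /mininf; case: ifP => // _.
by move/ltinf_nle: xy => /negbTE ->.
Qed.

(** In y - x = (l - x) - (l - y) the subtrahend has strictly larger value. *)
Lemma valB_lt l x y :
  ltinf (nu (l - x)) (nu (l - y)) -> nu (y - x) = nu (l - x).
Proof. by rewrite (valB l y) => /valD_lt <-; rewrite [l - x + _]addrC subrKA. Qed.

Lemma ltinf_valM c x y : c != 0 ->
  ltinf (nu x) (nu y) -> ltinf (nu (iota c * x)) (nu (iota c * y)).
Proof.
move=> c0; rewrite !valM; have [|g ->] := @val_neq0 (iota c).
  by rewrite fmorph_eq0.
by case: (nu x) (nu y) => [a|] [b|] //=; apply: oag_ltD2l.
Qed.

Lemma dist_valuesP M l g :
  dist_values nu l M g <-> exists2 x, M x & nu (l - x) = Some g.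
Proof.
split=> [[_ [x Mx <-] E]|[x Mx E]]; first by exists x.
by exists (l - x) => //; exists x.
Qed.

Lemma no_greatest_distP M l : submodule iota M ->
  no_greatest (values nu M) ->
  no_greatest (dist_values nu l M) <-> improvable nu M l.
Proof.
move=> sM ngM; split=> [ng x Mx nlx | imp [g]].
  have [|g Eg] := @val_neq0 (l - x); first by rewrite subr_eq0.
  have gx : dist_values nu l M g by apply/dist_valuesP; exists x.
  have [h /dist_valuesP [z Mz Ez] gh] := no_greatest_lt ng gx.
  by exists z; rewrite // Eg Ez.
move=> /dist_valuesP [x Mx Ex] ub.
have nle0 h : dist_values nu l M h -> ~ (g < h).
  by move=> /ub hg /lt_le_trans /(_ hg); rewrite ltxx.
have [|z Mz] := imp x Mx; first by rewrite -subr_eq0 (val_Some_neq0 Ex).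
rewrite Ex; case Ez: (nu (l - z)) => [h|] /= gh.
  by apply: (nle0 h) => //; apply/dist_valuesP; exists z.
(* An improvement of value oo means l = z lies in M. The distances from l then realise all values of
   M, among which g is not greatest. *)
have Ml : M l.
  by case: nu_val => nu0 _ _; move/nu0/subr0_eq: Ez => ->.
have [|h [w Mw Ew] gh'] := @no_greatest_lt _ _ g ngM.
  by exists (l - x) => //; apply: submoduleB.
apply: (nle0 h) => //; apply/dist_valuesP; exists (l - w).
  exact: submoduleB.
by rewrite opprB addrC subrK.
Qed.

(** If z improves on x, then z - x is an element of M with the same value as l - x. *)
Lemma improvable_dist_sub M l :
  submodule iota M -> improvable nu M l -> dist_values nu l M `<=` values nu M.
Proof.
move=> sM imp g /dist_valuesP [x Mx Ex].
have [|z Mz lt] := imp x Mx; first by rewrite -subr_eq0 (val_Some_neq0 Ex).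
exists (z - x); first exact: submoduleB.
by rewrite (valB_lt lt).
Qed.

Lemma pseudo_limitP M l : submodule iota M -> no_greatest (values nu M) ->
  pseudo_limit nu M l <-> improvable nu M l.
Proof.
move=> sM ngM; split=> [[_ /(no_greatest_distP _ sM ngM)] // | imp].
by split; [apply: improvable_dist_sub | apply/no_greatest_distP].
Qed.

Lemma improvable_mem M l : M l -> improvable nu M l.
Proof.
move=> Ml x _ nlx; exists l => //; rewrite subrr val0.
by have [|g ->] := @val_neq0 (l - x); rewrite ?subr_eq0.
Qed.

(** Improve x first to some y in N. As nu (y - x) = nu (l - x), an improvement z in M of x towards y
    also works for l, because l - z = (l - y) + (y - z). *)
Lemma improvable_trans M N l : M `<=` N ->
  (forall y, N y -> improvable nu M y) ->
  improvable nu N l -> improvable nu M l.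
Proof.
move=> MN impN impl x Mx nlx.
have [y Ny lxy] := impl x (MN x Mx) nlx.
have nyx : y != x.
  by apply/eqP => yx; move: lxy; rewrite yx ltinfxx.
have [z Mz] := impN y Ny x Mx nyx.
by rewrite (valB_lt lxy) => yz; exists z => //; rewrite -(subrKA y l (- z));
  exact: ltinf_valD.
Qed.

(** For c nonzero, approximating iota c * l + y by x amounts to approximating l by iota c^-1 * (x -
    y), up to translating values by nu (iota c). For c = 0 the element is y, already in M. *)
Lemma improvable_affine M c l y : submodule iota M ->
  improvable nu M l -> M y -> improvable nu M (iota c * l + y).
Proof.
move=> sM imp My; have [->|c0] := eqVneq c 0.
  by rewrite rmorph0 mul0r add0r; apply: improvable_mem.
have ic0 : iota c != 0 by rewrite fmorph_eq0.
have [_ MD MZ] := sM.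
have scale x : iota c * l + y - x = iota c * (l - iota c^-1 * (x - y)).
  by rewrite fmorphV mulrBr mulVKf // opprB addrA.
move=> x Mx nx; have [||z Mz lt] := imp (iota c^-1 * (x - y)).
- by apply: MZ; apply: submoduleB.
- by move: nx; rewrite -subr_eq0 scale mulf_eq0 negb_or ic0 subr_eq0.
exists (iota c * z + y); first by apply: MD => //; apply: MZ.
rewrite scale; have -> : iota c * l + y - (iota c * z + y) = iota c * (l - z).
  by rewrite opprD addrACA subrr addr0 mulrBr.
exact: ltinf_valM.
Qed.

End ModuleValuation.

(** * The filtration of K[chi] by degree *)

Section PolynomialModules.
Variables (K L : fieldType) (iota : {rmorphism K -> L}) (chi : L).

Lemma Kpoly_submodule m : submodule iota (Kpoly iota chi m).
Proof.
have E0 : Keval iota chi 0 = 0 by rewrite /Keval rmorph0 horner0.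
have ED p q : Keval iota chi p + Keval iota chi q = Keval iota chi (p + q).
  by rewrite /Keval rmorphD hornerD.
have EZ c p : iota c * Keval iota chi p = Keval iota chi (c *: p).
  by rewrite /Keval map_polyZ hornerZ.
case: m => [m|] /=; split.
- by exists 0; rewrite //= size_poly0.
- move=> _ _ [p /= sp <-] [q /= sq <-]; exists (p + q); rewrite ?ED //=.
  by rewrite (leq_trans (size_polyD p q)) // geq_max sp.
- move=> c _ [p /= sp <-]; exists (c *: p); rewrite ?EZ //=.
  exact: leq_trans (size_scale_leq c p) sp.
- by exists 0.
- by move=> _ _ [p _ <-] [q _ <-]; exists (p + q); rewrite ?ED.
- by move=> c _ [p _ <-]; exists (c *: p); rewrite ?EZ.
Qed.

Lemma Kpoly_sub m m' : leinf m m' -> Kpoly iota chi m `<=` Kpoly iota chi m'.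
Proof.
case: m m' => [m|] [m'|] //= le _ [p /= sp <-]; exists p => //=.
by apply: leq_trans sp _; rewrite ltnS.
Qed.

Lemma Kpoly_exp n : Kpoly iota chi (Some n) (chi ^+ n).
Proof.
exists 'X^n; first by rewrite /= size_polyXn.
by rewrite /Keval map_polyXn hornerXn.
Qed.

Lemma Kpoly_succ n l : Kpoly iota chi (Some n.+1) l ->
  exists c y, Kpoly iota chi (Some n) y /\ l = iota c * chi ^+ n.+1 + y.
Proof.
move=> [p /= sp <-]; exists p`_n.+1, (Keval iota chi (take_poly n.+1 p)).
split; first by exists (take_poly n.+1 p) => //=; apply: size_take_poly.
have {1}-> : p = p`_n.+1 *: 'X^(n.+1) + take_poly n.+1 p.
  apply/polyP => i; rewrite coefD coefZ coefXn coef_take_poly.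
  case: ltngtP => [lt|gt|->]; rewrite ?mulr1 ?mulr0 ?addr0 ?add0r //.
  by rewrite nth_default // (leq_trans sp).
by rewrite /Keval rmorphD hornerD /= map_polyZ map_polyXn hornerZ hornerXn.
Qed.

(** Each polynomial has finite degree, so even for d' = oo only finitely many levels above d are
    needed to reach l; this permits induction on k. *)
Lemma Kpoly_tower d d' l : leinf (Some d) d' -> Kpoly iota chi d' l ->
  exists k, leinf (Some (d + k)%N) d' /\ Kpoly iota chi (Some (d + k)%N) l.
Proof.
case: d' => [d'|] /= le; first by exists (d' - d)%N; rewrite subnKC.
move=> [p _ <-]; exists (size p); split=> //; exists p => //=.
by rewrite -addnS (leq_trans (leqnSn _)) ?leq_addl.
Qed.

End PolynomialModules.

(** * Climbing the tower one degree at a time *)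

Section Towers.
Variables (K L : fieldType) (iota : {rmorphism K -> L}).
Variables (G : oagType) (nu : L -> option G) (chi : L) (d : nat).
Variable d' : option nat.
Hypothesis nu_val : module_valuation iota nu.
Hypothesis le_dd' : leinf (Some d) d'.

Local Notation V m := (Kpoly iota chi m).

Lemma improvable_tower :
  (forall n, (d <= n)%N -> leinf (Some n.+1) d' ->
     improvable nu (V (Some n)) (chi ^+ n.+1)) ->
  forall l, V d' l -> improvable nu (V (Some d)) l.
Proof.
move=> step l /(Kpoly_tower le_dd') [k []].
elim: k l => [|k IH] l; first by rewrite addn0 => _; apply: (improvable_mem nu_val).
rewrite addnS => led' /Kpoly_succ [c [y [Vy ->]]].
(* Transitivity through level d + k: the induction hypothesis covers its elements, so l only has to
   be improved over that level. *)
apply: (improvable_trans (N := V (Some (d + k)%N)) nu_val).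
- by apply: Kpoly_sub; rewrite /= leEnat leq_addr.
- by move=> z; apply: IH; apply: leinf_pred.
apply: improvable_affine => //; first exact: Kpoly_submodule.
by apply: step => //; rewrite leq_addr.
Qed.

(* Values of [V d] have no greatest element and are stable under translation
   by [nu K], so exact approximation of the powers of [chi] gives approximation
   beyond any prescribed value. *)
Lemma approximable_tower :
  no_greatest (values nu (V (Some d))) ->
  (forall n, (d <= n)%N -> leinf (Some n.+1) d' ->
     values nu (V (Some d)) `<=` dist_values nu (chi ^+ n.+1) (V (Some n))) ->
  forall l g, V d' l -> values nu (V (Some d)) g ->
    exists2 z, V (Some d) z & ltinf (Some g) (nu (l - z)).
Proof.
move=> ng step l g /(Kpoly_tower le_dd') [k []] + + gd.
elim: k l => [|k IH] l.
  by rewrite addn0 => _ Vl; exists l; rewrite // subrr (val0 nu_val).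
rewrite addnS => led' /Kpoly_succ [c [y [Vy ->]]].
have led : leinf (Some (d + k)%N) d' by apply: leinf_pred.
have [->|c0] := eqVneq c 0.
  by rewrite rmorph0 mul0r add0r; apply: IH.
have ic0 : iota c != 0 by rewrite fmorph_eq0.
(* The target value h > g is divided by c: an element w with nu (chi ^+ (d + k).+1 - w) = nu (iota
   c^-1 * v) leaves, after multiplication by c, an error of value h. *)
have [h [v Vv Ev] gh] := no_greatest_lt ng gd.
have [_ _ VZd] := Kpoly_submodule iota chi (Some d).
have [_ VD VZ] := Kpoly_submodule iota chi (Some (d + k)%N).
have nv : iota c^-1 * v != 0.
  by rewrite mulf_neq0 ?(val_Some_neq0 nu_val Ev) // fmorphV invr_eq0.
have [a Ea] := val_neq0 nu_val nv.
have /dist_valuesP [w Vw Ew] :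
    dist_values nu (chi ^+ (d + k).+1) (V (Some (d + k)%N)) a.
  apply: step => //; first by rewrite leq_addr.
  by exists (iota c^-1 * v) => //; apply: VZd.
(* With the top power replaced by w, the element drops to level d + k and can be approximated from
   level d. *)
have [|z Vz gz] := IH (iota c * w + y) led; first by apply: VD => //; apply: VZ.
exists z => //.
have -> : iota c * chi ^+ (d + k).+1 + y - z =
    iota c * (chi ^+ (d + k).+1 - w) + (iota c * w + y - z).
  by rewrite mulrBr !addrA subrK.
apply: (ltinf_valD nu_val) => //.
by rewrite (valM nu_val) Ew -Ea -(valM nu_val) fmorphV mulVKf // Ev.
Qed.

End Towers.

(** * The criteria for immediate and dense extensions *)

Theorem proposition1p9 (K L : fieldType) (iota : {rmorphism K -> L})
  (G : oagType) (nu : L -> option G) (chi : L) (d d' : option nat)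
  (nu_val : module_valuation iota nu)
  (nuK_rank : finite_rank (values nu (range iota)))
  (lt_dd' : ltinf d d')
  (d'_deg : algebraicOver iota chi -> ltinf d' (Kdegree iota chi))
  (nu_no_greatest : forall m : option nat, leinf d m -> leinf m d' ->
     no_greatest (values nu (Kpoly iota chi m))) :
  (immediate nu (Kpoly iota chi d') (Kpoly iota chi d) <->
   forall n : nat, ltinf d (Some n) -> leinf (Some n) d' ->
     no_greatest (dist_values nu (chi ^+ n) (Kpoly iota chi (Some n.-1))))
  /\
  (pm_valuation iota chi nu ->
   is_subgroup (values nu (Kpoly iota chi d)) ->
   (dense_ext nu (Kpoly iota chi d') (Kpoly iota chi d) <->
    forall n : nat, ltinf d (Some n) -> leinf (Some n) d' ->
      dist_values nu (chi ^+ n) (Kpoly iota chi (Some n.-1))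
        = values nu (Kpoly iota chi d))).
Proof.
case: d lt_dd' nu_no_greatest => [{}d|] // lt ng.
have le_dd' : leinf (Some d) d' by case: d' lt {d'_deg ng} => //= e /ltW.
have subM := Kpoly_submodule iota chi.
have ngd : no_greatest (values nu (Kpoly iota chi (Some d))).
  by apply: ng; rewrite //= lexx.
(* Isolated because the dense case reuses it to obtain one of its inclusions. *)
have imm_iff : immediate nu (Kpoly iota chi d') (Kpoly iota chi (Some d)) <->
    forall n : nat, ltinf (Some d) (Some n) -> leinf (Some n) d' ->
      no_greatest (dist_values nu (chi ^+ n) (Kpoly iota chi (Some n.-1))).
  split=> [imm [//|n] dn nd' | pow l Vl].
    have ngn : no_greatest (values nu (Kpoly iota chi (Some n))).
      by apply: ng => //; apply: leinf_pred.
    apply/(no_greatest_distP nu_val) => // x Vx nx.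
    have Vl : Kpoly iota chi d' (chi ^+ n.+1 - x).
      apply: (Kpoly_sub nd'); apply: (submoduleB (subM _)).
        exact: Kpoly_exp.
      by apply: Kpoly_sub Vx; rewrite /= leEnat.
    (* Improving the approximation 0 of chi ^+ n.+1 - x by z in K_d[chi] improves x to x + z, still
       in K_n[chi] since d <= n. *)
    have /(pseudo_limitP nu_val) imp := imm _ Vl.
    have [] := imp (subM _) ngd 0; first by case: (subM (Some d)).
      by rewrite subr_eq0.
    move=> z Vz; rewrite subr0 -addrA -opprD => lxz; exists (x + z) => //.
    have [_ VD _] := subM (Some n); apply: VD => //.
    by apply: Kpoly_sub Vz.
  apply/(pseudo_limitP nu_val) => //.
  apply: (improvable_tower nu_val le_dd') Vl => n dn nd'.
  apply/(no_greatest_distP nu_val) => //.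
    by apply: ng => //; apply: leinf_pred.
  exact: (pow n.+1).
split=> // _ _; split=> [dense [//|n] dn nd' | pow l Vl].
  apply/seteqP; split=> g.
    move=> /dist_valuesP [x Vx Ex].
    (* The value g is the distance from chi ^+ n.+1 - x to 0, hence a value of K_d[chi] by density
       at that element. *)
    rewrite -(dense (chi ^+ n.+1 - x)); last first.
      apply: (Kpoly_sub nd'); apply: (submoduleB (subM _)).
        exact: Kpoly_exp.
      by apply: Kpoly_sub Vx; rewrite /= leEnat.
    by apply/dist_valuesP; exists 0; rewrite ?subr0 //; case: (subM (Some d)).
  rewrite -(dense (chi ^+ n.+1)); last exact: (Kpoly_sub nd') (Kpoly_exp _ _ _).
  move=> /dist_valuesP [x Vx Ex]; apply/dist_valuesP; exists x => //.
  exact: Kpoly_sub Vx.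
(* By hypothesis the distance sets of the powers equal the values of K_d[chi], which have no
   greatest element. *)
have imm : immediate nu (Kpoly iota chi d') (Kpoly iota chi (Some d)).
  by apply/imm_iff => n dn nd'; rewrite pow.
apply/seteqP; split=> [|g gd]; first by case: (imm l Vl).
have [|z Vz gz] := approximable_tower nu_val le_dd' ngd _ Vl gd.
  by move=> n dn nd'; rewrite -(pow n.+1).
(* To hit g exactly, an approximation z beyond g is perturbed by v of value g: l - (z - v) = v + (l
   - z), where v dominates. *)
have [v Vv Ev] := gd; apply/dist_valuesP; exists (z - v).
  exact: submoduleB.
by rewrite opprB addrCA (valD_lt nu_val) ?Ev.
Qed.
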